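(* For every integer $n>0$, $\mathrm{DE2}(n)+\mathrm{DE2}(n-3)=\mathrm{ped}_{n>1}(n)$; that is, $\mathrm{DE2}(n)+\mathrm{DE2}(n-3)$ equals the number of $4$-regular partitions of $n$ into parts each $>1$.
   Context: A partition of a positive integer $n$ is a finite non-increasing sequence $\lambda=(\lambda_1,\ldots,\lambda_k)$ of positive integers with $\sum_{i=1}^k\lambda_i=n$. $\mathrm{DE2}(n)$ is the number of partitions of $n$ in which no even part is repeated and the largest part is odd and appears at least twice; equivalently $\sum_{n\ge 0}\mathrm{DE2}(n)q^n=\sum_{n\ge0}\frac{(-q^2;q^2)_n q^{4n+2}}{(q;q^2)_{n+1}}$, where $(a;q)_n=\prod_{j=0}^{n-1}(1-aq^j)$. In particular $\mathrm{DE2}(m)=0$ for all integers $m\le 0$. $\mathrm{ped}_{n>1}(n)$ (the subscript is only part of the name) is the number of partitions of $n$ in which no even part is repeated (odd parts may repeat) and every part is strictly larger than $1$. A $4$-regular partition is a partition none of whose parts is divisible by $4$. *)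

(* Defs.v *)
From mathcomp Require Import all_boot all_order all_algebra.

Set Implicit Arguments.
Unset Strict Implicit.
Unset Printing Implicit Defensive.

Import Order.TTheory GRing.Theory Num.Theory.

(* The argument m is an int because the counting functions below are evaluated
   at possibly negative arguments, which have no partition. *)
Definition is_partition (m : int) (s : seq nat) : bool :=
  [&& sorted geq s, all (ltn 0) s & Posz (sumn s) == m].

(* A partition of m >= 0 has at most m parts, each at most m; the bounded
   sequences therefore miss no partition (see num_partitionsP). *)
Definition num_partitions (P : pred (seq nat)) (m : int) : nat :=
  #|[set s : `|m|.-bseq 'I_`|m|.+1 |
      is_partition m (map val s) && P (map val s)]|.

Definition even_parts_distinct (s : seq nat) : bool :=
  all (fun p => ~~ odd p ==> (count_mem p s <= 1)) s.

(* For a non-increasing sequence the head is the largest part; the default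
   value 0 is even, so the empty sequence is excluded. *)
Definition largest_part_odd_repeated (s : seq nat) : bool :=
  odd (head 0 s) && (2 <= count_mem (head 0 s) s).

Definition parts_gt1 (s : seq nat) : bool := all (ltn 1) s.

Definition four_regular (s : seq nat) : bool := all (fun p => ~~ (4 %| p)) s.

Definition DE2 (m : int) : nat :=
  num_partitions
    (fun s => even_parts_distinct s && largest_part_odd_repeated s) m.

Definition ped_gt1 (m : int) : nat :=
  num_partitions (fun s => even_parts_distinct s && parts_gt1 s) m.

Definition four_regular_gt1 (m : int) : nat :=
  num_partitions (fun s => four_regular s && parts_gt1 s) m.

Lemma is_partition_bseq (m : int) (s : seq nat) :
  is_partition m s -> exists t : `|m|.-bseq 'I_`|m|.+1, map val t = s.
Proof.
case/and3P=> _ s_gt0 /eqP <- /=.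
have size_s : size s <= sumn s.
  elim: s s_gt0 => //= x s IHs /andP[x_gt0 /IHs].
  by rewrite -add1n; apply: leq_add.
have le_s : all (fun x => x < (sumn s).+1) s.
  apply/allP=> x; elim: s {s_gt0 size_s} => //= y s IHs.
  rewrite inE ltnS => /orP[/eqP-> | /IHs]; first exact: leq_addr.
  by rewrite ltnS => /leq_trans-> //; apply: leq_addl.
have size_t : size (map (@inord (sumn s)) s) <= sumn s by rewrite size_map.
exists (Bseq size_t) => /=; rewrite -map_comp map_id_in // => x xs.
by rewrite /= inordK // (allP le_s).
Qed.

Lemma num_partitionsP (P : pred (seq nat)) (m : int) (l : seq (seq nat)) :
  uniq l -> (forall s, (s \in l) = is_partition m s && P s) ->
  num_partitions P m = size l.
Proof.
move=> uniq_l lP; rewrite /num_partitions.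
set A := [set s | _].
have inj : injective (fun t : `|m|.-bseq 'I_`|m|.+1 => map val t).
  by move=> t u /(inj_map val_inj) /val_inj.
rewrite cardE -(size_map (fun t : `|m|.-bseq 'I_`|m|.+1 => map val t)).
apply/perm_size/uniq_perm => //; first by rewrite map_inj_uniq ?enum_uniq.
move=> s; rewrite lP; apply/mapP/idP => [[t] | sP].
  by rewrite mem_enum inE => tP ->.
have [t def_s] := is_partition_bseq (andP sP).1.
by exists t; rewrite // mem_enum inE def_s.
Qed.

Lemma DE2_le0 (m : int) : (m <= 0)%R -> DE2 m = 0.
Proof.
move=> m_le0; apply: (@num_partitionsP _ _ [::]) => // s.
rewrite in_nil; apply/esym/negbTE/negP => /andP[/and3P[_ s_gt0 /eqP def_m]].
case: s s_gt0 def_m => [|x s] /=.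
  by rewrite /largest_part_odd_repeated andbF.
case/andP=> x_gt0 _ def_m; move: m_le0.
by rewrite -def_m lez_nat leqn0 addn_eq0 eqn0Ngt x_gt0.
Qed.

(* Main.v *)
Require Import Defs.
From mathcomp Require Import all_boot all_order all_algebra.
From mathcomp Require Import ring zify.

(* Generating functions of degree at most n are computed in a commutative ring
   with an element x such that x^(n+1) = 0; in the end this ring is
   Z[X]/(X^(n+1)).  With A_N = prod_(i < N) (1 + x^(2i+2)) / (1 - x^(2i+1)),
   sorting by the largest part 2i+1 gives
     sum_m DE2(m) x^m = sum_i x^(2(2i+1)) A_i / (1 - x^(2i+1)),
   and the generating function of ped_gt1 is (1 - x) A_N for large N.  The terms
   of the first sum, multiplied by 1 + x^3, are the successive differences of
   (1 - x + x^(2N+1)) A_N, whence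
     1 + (1 + x^3) sum_m DE2(m) x^m = sum_m ped_gt1(m) x^m.
   The 4-regular partitions are handled by Euler's "distinct parts = odd parts"
   applied to the halves of the even parts. *)

Set Implicit Arguments.
Unset Strict Implicit.
Unset Printing Implicit Defensive.

Import GRing.Theory Num.Theory.

(** * Partitions and multiplicities *)

Lemma is_partitionP (m : nat) (s : seq nat) :
  is_partition m s -> [/\ sorted geq s, forall p, p \in s -> 0 < p <= m,
    sumn s = m & forall p, count_mem p s <= m].
Proof.
move=> s_part; have [t def_s] := is_partition_bseq s_part.
case/and3P: s_part => s_sorted /allP s_gt0 /eqP[sum_s].
have size_s : size s <= m by rewrite -def_s size_map size_bseq.
split=> // [p ps|p]; last exact: leq_trans (count_size _ _) size_s.
apply/andP; split; first exact: s_gt0.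
move: ps; rewrite -def_s => /mapP[i _ ->].
by rewrite -ltnS; exact: ltn_ord i.
Qed.

Lemma eq_num_partitions (m : int) (P Q : pred (seq nat)) :
  (forall s, is_partition m s -> P s = Q s) ->
  num_partitions P m = num_partitions Q m.
Proof.
move=> eqPQ; apply: eq_card => s; rewrite !inE.
by have [/eqPQ->|] := boolP (is_partition _ _).
Qed.

(** Equating a boolean with a sum of booleans says at once that the [Q i] cover [P] and exclude one
    another. *)
Lemma num_partitions_sum (m : int) (N : nat) (P : pred (seq nat))
    (Q : 'I_N -> pred (seq nat)) :
  (forall s, is_partition m s -> nat_of_bool (P s) = \sum_i Q i s) ->
  num_partitions P m = \sum_i num_partitions (Q i) m.
Proof.
move=> defP; rewrite /num_partitions -sum1dep_card big_mkcond /=.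
under [RHS]eq_bigr => i _ do rewrite -sum1dep_card big_mkcond /=.
rewrite exchange_big /=; apply: eq_bigr => s _.
have [/defP|_] := boolP (is_partition _ _); last by rewrite big1.
rewrite andTb => Ps; transitivity (nat_of_bool (P (map val s))).
  by case: (P _).
by rewrite Ps; apply: eq_bigr => i _ /=; case: (Q i _).
Qed.

(** [S k j] allows the part k to occur j times. Constraining each multiplicity separately is what
    makes the generating function a product over k. *)
Definition multiplicities_in (S : nat -> nat -> bool) (K : nat)
    (s : seq nat) : bool :=
  all (fun k => S k (count_mem k s)) (iota 1 K).

Lemma all_parts (m K : nat) (s : seq nat) (Q : pred nat) :
  is_partition m s -> m <= K ->
  all Q s = all (fun k => (count_mem k s == 0) || Q k) (iota 1 K).
Proof.
case/is_partitionP => _ s_bnd _ _ le_mK; apply/allP/allP => [Qs k _ | Qs k ks].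
  by have [/Qs->|/count_memPn->] := boolP (k \in s); rewrite ?orbT.
have /andP[k_gt0 le_km] := s_bnd k ks.
have /Qs : k \in iota 1 K.
  by rewrite mem_iota k_gt0 add1n ltnS (leq_trans le_km).
by rewrite -leqn0 leqNgt -has_count has_pred1 ks.
Qed.

Definition parts_of_multiplicities (K J : nat) (f : {ffun 'I_K -> 'I_J}) :=
  sort geq (flatten [seq nseq (f k) k.+1 | k <- enum 'I_K]).

Lemma count_parts_of_multiplicities K J (f : {ffun 'I_K -> 'I_J}) (p : nat) :
  count_mem p (parts_of_multiplicities f) = \sum_(k < K) (k.+1 == p) * f k.
Proof.
rewrite (permP (permEl (perm_sort _ _))) count_flatten -map_comp sumnE big_map.
by rewrite big_enum; apply: eq_bigr => k _; rewrite /= count_nseq.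
Qed.

Lemma count_parts_of_multiplicities_ord K J (f : {ffun 'I_K -> 'I_J})
    (k : 'I_K) :
  count_mem k.+1 (parts_of_multiplicities f) = f k.
Proof.
rewrite count_parts_of_multiplicities (bigD1 k) //= eqxx mul1n big1 ?addn0 //.
by move=> i; rewrite -val_eqE eqSS => /negbTE->.
Qed.

Lemma parts_of_multiplicities_partition K J (f : {ffun 'I_K -> 'I_J}) :
  is_partition (\sum_(k < K) k.+1 * f k)%N (parts_of_multiplicities f).
Proof.
rewrite /is_partition sort_sorted => [|a b]; last exact: leq_total.
rewrite andTb all_sort; apply/andP; split=> [|/=].
  by apply/allP=> p /flatten_mapP[k _ /nseqP[->]].
rewrite eqz_nat (perm_sumn (permEl (perm_sort _ _))) sumn_flatten -map_comp.
by rewrite sumnE big_map big_enum; apply/eqP/eq_bigr => k _ /=;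
  rewrite sumn_nseq.
Qed.

(** [parts_of_multiplicities] is the bijection, index k standing for the part k+1. Parts and
    multiplicities of a partition of m are at most m, so they fit into ['I_K] (after the shift) and
    ['I_J]. *)
Lemma num_partitions_multiplicities (S : nat -> nat -> bool) (m J K : nat) :
  m <= K -> m < J ->
  num_partitions (multiplicities_in S K) m =
  #|[set f : {ffun 'I_K -> 'I_J} |
      [forall k : 'I_K, S k.+1 (f k)] & (\sum_(k < K) k.+1 * f k == m)]|.
Proof.
case: J => // J le_mK lt_mJ; set A := [set f | _ & _].
have inj : injective (@parts_of_multiplicities K J.+1).
  move=> f g eq_fg; apply/ffunP => k; apply: val_inj => /=.
  by rewrite -!count_parts_of_multiplicities_ord eq_fg.
rewrite cardE -(size_map (@parts_of_multiplicities K J.+1)).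
apply: num_partitionsP => [|s]; first by rewrite map_inj_uniq ?enum_uniq.
apply/mapP/andP => [[f] | [s_part /allP Ss]].
  rewrite mem_enum inE => /andP[/forallP Sf /eqP <-] ->.
  split; first exact: parts_of_multiplicities_partition f.
  apply/allP=> k; rewrite mem_iota add1n ltnS; case: k => // k /= lt_kK.
  rewrite (count_parts_of_multiplicities_ord f (Ordinal lt_kK)).
  exact: Sf (Ordinal lt_kK).
have [s_sorted s_bnd sum_s s_count] := is_partitionP s_part.
pose f := [ffun k : 'I_K => inord (count_mem k.+1 s) : 'I_J.+1].
have fE k : f k = count_mem k.+1 s :> nat.
  by rewrite ffunE inordK // (leq_ltn_trans (s_count _)).
have def_s : s = parts_of_multiplicities f.
  have [f_sorted _ _ _] := is_partitionP (parts_of_multiplicities_partition f).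
  apply: (@sorted_eq _ geq) => //.
  - by move=> a b c /= le_ab le_ca; apply: leq_trans le_ca le_ab.
  - by move=> a b; rewrite andbC => /anti_leq.
  apply/allP=> p; rewrite mem_cat => p_in /=; apply/eqP.
  have p_bnd: 0 < p <= K.
    case/orP: p_in => [/s_bnd/andP[-> /leq_trans->] //|].
    by rewrite mem_sort => /flatten_mapP[k _ /nseqP[-> _]] /=.
  case: p p_bnd {p_in} => // k lt_kK.
  by rewrite (count_parts_of_multiplicities_ord f (Ordinal lt_kK)) fE.
exists f => //; rewrite mem_enum inE; apply/andP; split.
  apply/forallP => k; rewrite fE; apply: Ss.
  by rewrite mem_iota add1n /= ltnS ltn_ord.
have /is_partitionP[_ _ sum_f _] := parts_of_multiplicities_partition f.
by rewrite -sum_f -def_s sum_s.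
Qed.

(** Partitions are sorted by their largest part 2i+1, which is at most m, so i < N. Forbidding
    larger parts and requiring 2i+1 twice turns the condition on the head into one on
    multiplicities. *)
Lemma DE2_sum (m N : nat) : m <= 2 * N ->
  DE2 m = \sum_(i < N) num_partitions (multiplicities_in (fun k j =>
    ((j == 0) || ((~~ odd k ==> (j <= 1)) && (k <= 2 * i + 1)))
      && ((k == 2 * i + 1) ==> (2 <= j))) (2 * N)) m.
Proof.
move=> le_m2N; apply: num_partitions_sum => s s_part.
have [s_sorted s_bnd _ _] := is_partitionP s_part.
transitivity (\sum_(i < N) (even_parts_distinct s &&
    ((head 0 s == 2 * i + 1) && (2 <= count_mem (2 * i + 1) s)))).
  rewrite /largest_part_odd_repeated.
  have [head_odd | head_even] := boolP (odd (head 0 s)); last first.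
    rewrite andbF big1 // => i _; case: eqP => [head_s|]; last by rewrite andbF.
    by move: head_even; rewrite head_s; lia.
  have head_s : head 0 s = 2 * (head 0 s)./2 + 1 by lia.
  have lt_headN : (head 0 s)./2 < N.
    have /s_bnd : head 0 s \in s.
      by case: (s) head_odd => //= h t; rewrite mem_head.
    by lia.
  rewrite (bigD1 (Ordinal lt_headN)) //= -head_s eqxx big1 ?addn0 // => i.
  rewrite -val_eqE /= => i_neq; case: eqP => [head_i|]; last by rewrite andbF.
  by lia.
apply: eq_bigr => i _; congr nat_of_bool.
rewrite /multiplicities_in.
rewrite -[RHS]/(all (predI (fun k => (count_mem k s == 0) ||
   ((~~ odd k ==> (count_mem k s <= 1)) && (k <= 2 * i + 1)))
  (fun k => (k == 2 * i + 1) ==> (2 <= count_mem k s))) (iota 1 (2 * N))).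
rewrite all_predI -(all_parts _ s_part le_m2N).
rewrite (all_predI (fun k => ~~ odd k ==> (count_mem k s <= 1))
  (geq (2 * i + 1))).
rewrite -andbA.
congr (_ && _).
have -> : all (fun k => (k == 2 * i + 1) ==> (1 < count_mem k s))
              (iota 1 (2 * N)) = (1 < count_mem (2 * i + 1) s).
  apply/allP/idP => [/(_ (2 * i + 1)) | count_i k _].
    by rewrite eqxx; apply; rewrite mem_iota; have := ltn_ord i; lia.
  by apply/implyP => /eqP->.
(* Once 2i+1 occurs in the non-increasing [s], it is the head exactly when no part exceeds it. *)
rewrite andbC [RHS]andbC; have [i_rep /= | //] := boolP (1 < count_mem _ s).
have i_s : 2 * i + 1 \in s by rewrite -has_pred1 has_count ltnW.
case: s s_sorted i_s {s_part s_bnd i_rep} => // h t /= /order_path_min h_max.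
have h_ge : all (geq h) t.
  by apply: h_max => a b c /= le_ab le_ca; apply: leq_trans le_ca le_ab.
rewrite inE; case: eqP => [-> _ | neq_hi /(allP h_ge) /= le_ih].
  by rewrite eqxx leqnn h_ge.
have -> : (h <= 2 * i + 1) = false by lia.
by lia.
Qed.

Lemma ped_gt1_multiplicities (m K : nat) : m <= K ->
  ped_gt1 m = num_partitions (multiplicities_in (fun k j =>
    (j == 0) || ((~~ odd k ==> (j <= 1)) && (1 < k))) K) m.
Proof.
move=> le_mK; apply: eq_num_partitions => s s_part.
by rewrite -all_predI (all_parts _ s_part le_mK).
Qed.

Lemma four_regular_gt1_multiplicities (m K : nat) : m <= K ->
  four_regular_gt1 m = num_partitions (multiplicities_in (fun k j =>
    (j == 0) || (~~ (4 %| k) && (1 < k))) K) m.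
Proof.
move=> le_mK; apply: eq_num_partitions => s s_part.
by rewrite -all_predI (all_parts _ s_part le_mK).
Qed.

(** * Products in a ring with a nilpotent element *)

Section GeneratingFunctions.
Local Open Scope ring_scope.

Variables (R : comNzRingType) (x : R) (n : nat).
Hypothesis x_nilp : x ^+ n.+1 = 0.

Lemma expr_nilp m : (n < m)%N -> x ^+ m = 0.
Proof. by move/subnK <-; rewrite exprD x_nilp mulr0. Qed.

(** Expanding the product chooses a multiplicity for each part. The choices of weight m <= n are
    those counted by [num_partitions_multiplicities]; heavier ones vanish by nilpotency. *)
Lemma prod_multiplicities (S : nat -> nat -> bool) (K : nat) : (n <= K)%N ->
  \prod_(k < K) \sum_(j < n.+1 | S k.+1 j) x ^+ (k.+1 * j) =
  \sum_(m < n.+1) x ^+ m *+ num_partitions (multiplicities_in S K) m.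
Proof.
move=> le_nK; rewrite bigA_distr_big_dep /=.
under [RHS]eq_bigr => m _.
  rewrite (@num_partitions_multiplicities S m n.+1) //; last first.
    by rewrite (leq_trans _ le_nK) // -ltnS.
  rewrite -sumr_const; under eq_bigl => f do rewrite inE; over.
rewrite (exchange_big_dep xpredT) //= big_mkcond; apply: eq_bigr => f _.
have -> : (f \in family (fun k : 'I_K => [pred j : 'I_n.+1 | S k.+1 j])) =
          [forall k : 'I_K, S k.+1 (f k)] by [].
case: ifP => _; last by rewrite big_pred0.
rewrite -expr_sum; set w := (\sum_(k < K) _)%N.
have [lt_wn|lt_nw] := ltnP w n.+1.
  by rewrite (big_pred1 (Ordinal lt_wn)) // => m; rewrite /= -val_eqE eq_sym.
rewrite expr_nilp // big1 // => m; rewrite andTb => /eqP w_m.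
by move: (ltn_ord m); rewrite -w_m ltnNge lt_nw.
Qed.

Definition geom (k : nat) : R := \sum_(j < n.+1) x ^+ (k * j).

Lemma mul_geom k : (0 < k)%N -> (1 - x ^+ k) * geom k = 1.
Proof.
move=> k_gt0; rewrite /geom; under eq_bigr => j _ do rewrite exprM.
apply: oppr_inj; rewrite -mulNr opprB -subrX1 -exprM expr_nilp ?sub0r //.
by rewrite leq_pmull.
Qed.

Lemma prod_geom (I : Type) (r : seq I) (k : I -> nat) :
    (forall i, (0 < k i)%N) ->
  (\prod_(i <- r) (1 - x ^+ k i)) * \prod_(i <- r) geom (k i) = 1.
Proof.
by move=> k_gt0; rewrite -big_split big1 //= => i _; rewrite mul_geom.
Qed.

Lemma sum_multiplicity_le1 k : (0 < k)%N ->
  \sum_(j < n.+1 | (j <= 1)%N) x ^+ (k * j) = 1 + x ^+ k.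
Proof.
move=> k_gt0; case: (n) x_nilp => [|m] xm.
  (* For n = 0 only j = 0 is in range, but then x = 0, so the missing x^k is 0. *)
  rewrite big_mkcond big_ord1 muln0 expr0.
  by move: xm; rewrite expr1 => ->; rewrite expr0n eqn0Ngt k_gt0 addr0.
rewrite big_mkcond !big_ord_recl /= muln0 muln1 expr0 big1 ?addr0 //.
Qed.

Lemma sum_multiplicity_ge2 k : (0 < k)%N ->
  \sum_(j < n.+1 | (2 <= j)%N) x ^+ (k * j) = x ^+ (2 * k) * geom k.
Proof.
move=> k_gt0; have gk := mul_geom k_gt0.
have geomE : geom k = 1 + x ^+ k + \sum_(j < n.+1 | (2 <= j)%N) x ^+ (k * j).
  rewrite -sum_multiplicity_le1 // /geom.
  rewrite (bigID (fun j : 'I__ => (j <= 1)%N)) /=.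
  by congr (_ + _); apply: eq_bigl => j; rewrite ltnNge.
have -> : \sum_(j < n.+1 | (2 <= j)%N) x ^+ (k * j) = geom k - (1 + x ^+ k).
  by rewrite geomE; ring.
apply/eqP; rewrite mulnC exprM -subr_eq0.
have -> : geom k - (1 + x ^+ k) - (x ^+ k) ^+ 2 * geom k =
          (1 + x ^+ k) * ((1 - x ^+ k) * geom k - 1) by ring.
by rewrite gk subrr mulr0.
Qed.

Lemma sum_multiplicity_eq0 k :
  \sum_(j < n.+1 | j == 0%N :> nat) x ^+ (k * j) = 1.
Proof. by rewrite (big_pred1 ord0) ?muln0. Qed.

(** This is A_N: up to degree n, it enumerates the partitions into parts at most 2N with no even
    part repeated. *)
Definition ped_prod N : R :=
  \prod_(i < N) (geom (2 * i + 1) * (1 + x ^+ (2 * i + 2))).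

(** With y = x^(2N+1), the induction step is (1 - x + x^2 y)(1 + xy) - (1 - x + y)(1 - y) = (1 +
    x^3) y^2. *)
Lemma ped_prod_telescope N :
  (1 - x + x ^+ (2 * N + 1)) * ped_prod N =
  1 + (1 + x ^+ 3) *
    \sum_(i < N) x ^+ (2 * (2 * i + 1)) * (ped_prod i * geom (2 * i + 1)).
Proof.
elim: N => [|N IH]; first by rewrite /ped_prod !big_ord0 expr1; ring.
rewrite big_ord_recr [ped_prod N.+1]big_ord_recr /= -/(ped_prod N).
rewrite [X in _ = 1 + X]mulrDr [RHS]addrA -IH.
have := mul_geom (ltn_addl (2 * N)%N (ltn0Sn 0)).
rewrite (_ : 2 * N.+1 + 1 = (2 * N + 1) + 2)%N; last by lia.
rewrite (_ : 2 * N + 2 = (2 * N + 1) + 1)%N; last by lia.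
rewrite [(2 * (2 * N + 1))%N]mulnC exprM [x ^+ (2 * N + 1 + 2)]exprD.
rewrite [x ^+ (2 * N + 1 + 1)]exprD.
set y := x ^+ (2 * N + 1); set g := geom _; set A := ped_prod N => yg.
(* Inserting (1 - y) g = 1 into the only term without g makes every term a multiple of g A, and a
   polynomial identity remains. *)
have -> : (1 - x + y) * A = (1 - x + y) * A * ((1 - y) * g) by rewrite yg mulr1.
ring.
Qed.

(** Euler's theorem with all parts doubled: the two sides agree after multiplication by the
    invertible product of the 1 - x^(4i+4). *)
Lemma prod_geom_distinct N : (n <= 2 * N)%N ->
  \prod_(i < N) geom (4 * i + 2) =
  \prod_(i < N) ((1 + x ^+ (4 * i + 2)) * (1 + x ^+ (4 * i + 4))).
Proof.
move=> le_n2N; set L := LHS; set P := RHS.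
pose D M := \prod_(i < M) (1 - x ^+ (4 * i + 4)).
have D2 M : D (M + M)%N =
    \prod_(i < M) ((1 - x ^+ (8 * i + 4)) * (1 - x ^+ (8 * i + 8))).
  elim: M => [|M IH]; first by rewrite /D !big_ord0.
  rewrite addnS /D !big_ord_recr /= -/(D (M + M)%N) IH -mulrA.
  rewrite (_ : 4 * (M + M) + 4 = 8 * M + 4)%N; last by lia.
  by rewrite (_ : 4 * (M + M).+1 + 4 = 8 * M + 8)%N //; lia.
(* The factors added by doubling the range have exponents above n, hence equal 1. This replaces the
   passage to an infinite product. *)
have DN : D (N + N)%N = D N.
  rewrite /D big_split_ord /= [X in _ * X]big1 ?mulr1 // => i _.
  by rewrite expr_nilp ?subr0 //; lia.
(* With y = x^(4i+2): 1 + y = (1 - y^2) / (1 - y). *)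
have PD : P * D N = L * D N.
  rewrite -{2}DN D2 /P /L /D -!big_split; apply: eq_bigr => i _ /=.
  have gi := mul_geom (ltn_addl (4 * i)%N (ltn0Sn 1)).
  rewrite (_ : 8 * i + 4 = (4 * i + 2) * 2)%N; last by lia.
  rewrite (_ : 8 * i + 8 = (4 * i + 4) * 2)%N; last by lia.
  rewrite !exprM; set y := x ^+ _ in gi *; set g := geom _ in gi *.
  have -> : 1 + y = (1 - y ^+ 2) * g.
    by rewrite -[LHS]mulr1 -[X in _ * X]gi; ring.
  ring.
have DG : D N * \prod_(i < N) geom (4 * i + 4) = 1.
  by apply: prod_geom => i; rewrite addnS.
by rewrite -[L]mulr1 -[P]mulr1 -DG !mulrA PD.
Qed.

End GeneratingFunctions.

(** * Generating functions of the counting functions *)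

Section CountingFunctions.
Local Open Scope ring_scope.

Lemma prod_ord_double (R : comNzRingType) (N : nat) (F : nat -> R) :
  \prod_(k < 2 * N) F k = \prod_(i < N) (F (2 * i)%N * F (2 * i + 1)%N).
Proof.
elim: N => [|N IH]; first by rewrite !big_ord0.
by rewrite mulnS !big_ord_recr /= IH mulrA addn1.
Qed.

Variables (R : comNzRingType) (x : R) (n : nat).
Hypothesis x_nilp : x ^+ n.+1 = 0.
Notation geom := (geom x n).
Notation ped_prod := (ped_prod x n).
Notation gen_fun c := (\sum_(m < n.+1) x ^+ m *+ c (Posz m)).

Lemma gen_fun_DE2 N : (n <= 2 * N)%N ->
  gen_fun DE2 =
  \sum_(i < N) x ^+ (2 * (2 * i + 1)) * (ped_prod i * geom (2 * i + 1)).
Proof.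
move=> le_n2N.
under eq_bigr => m _.
  have le_m2N : (m <= 2 * N)%N by apply: leq_trans le_n2N; rewrite -ltnS.
  rewrite (DE2_sum le_m2N) -sumrMnr; over.
rewrite exchange_big /=; apply: eq_bigr => i _.
rewrite -(prod_multiplicities x_nilp) //.
pose F k := \sum_(j < n.+1 | ((j == 0 :> nat) ||
    ((~~ odd k.+1 ==> (j <= 1)%N) && (k.+1 <= 2 * i + 1)%N)) &&
    ((k.+1 == 2 * i + 1)%N ==> (2 <= j)%N)) x ^+ (k.+1 * j).
rewrite (@prod_ord_double _ N F).
(* Index 2a stands for the odd part 2a+1: unrestricted below the largest part 2i+1, at least two
   copies at it, absent above it. *)
have F_odd (a : nat) : F (2 * a)%N = if (a < i)%N then geom (2 * a + 1) else
    if a == i then x ^+ (2 * (2 * a + 1)) * geom (2 * a + 1) else 1.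
  rewrite /F (_ : (2 * a).+1 = 2 * a + 1)%N; last by lia.
  case: ltngtP => lt_ai.
  - by apply: eq_bigl => j; lia.
  - rewrite -[RHS](sum_multiplicity_eq0 x n (2 * a + 1)).
    by apply: eq_bigl => j; lia.
  - rewrite -(sum_multiplicity_ge2 x_nilp); last by lia.
    by apply: eq_bigl => j; lia.
have F_even (a : nat) :
    F (2 * a + 1)%N = if (a < i)%N then 1 + x ^+ (2 * a + 2) else 1.
  rewrite /F (_ : (2 * a + 1).+1 = 2 * a + 2)%N; last by lia.
  case: ltnP => lt_ai.
    rewrite -(sum_multiplicity_le1 x_nilp); last by lia.
    by apply: eq_bigl => j; lia.
  rewrite -[RHS](sum_multiplicity_eq0 x n (2 * a + 2)).
  by apply: eq_bigl => j; lia.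
under eq_bigr => a _ do rewrite F_odd F_even.
rewrite (bigID (fun a : 'I_N => (a < i)%N)) /=.
rewrite /ped_prod (big_ord_widen N
  (fun a => geom (2 * a + 1) * (1 + x ^+ (2 * a + 2)))) 1?ltnW //.
rewrite [X in _ * X](bigD1 i) ?ltnn //= eqxx mulr1.
rewrite [X in _ * (_ * X)]big1 => [|a]; last first.
  by rewrite -val_eqE /= => /andP[/negbTE-> /negbTE->]; rewrite mulr1.
rewrite mulr1 mulrCA; congr (_ * (_ * _)).
by apply: eq_bigr => a ->.
Qed.

Lemma gen_fun_ped_gt1 N : (n <= 2 * N)%N ->
  gen_fun ped_gt1 = \prod_(i < N)
    ((if i == 0%N :> nat then 1 else geom (2 * i + 1)) *
     (1 + x ^+ (2 * i + 2))).
Proof.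
move=> le_n2N.
under eq_bigr => m _.
  have le_m2N : (m <= 2 * N)%N by apply: leq_trans le_n2N; rewrite -ltnS.
  rewrite (ped_gt1_multiplicities le_m2N); over.
rewrite -(prod_multiplicities x_nilp) //.
pose F k := \sum_(j < n.+1 | (j == 0 :> nat) ||
  ((~~ odd k.+1 ==> (j <= 1)%N) && (1 < k.+1)%N)) x ^+ (k.+1 * j).
rewrite (@prod_ord_double _ N F); apply: eq_bigr => i _.
congr (_ * _); rewrite /F.
  rewrite (_ : (2 * i).+1 = 2 * i + 1)%N; last by lia.
  case: eqP => i0; last by apply: eq_bigl => j; lia.
  rewrite -[RHS](sum_multiplicity_eq0 x n (2 * i + 1)).
  by apply: eq_bigl => j; lia.
rewrite (_ : (2 * i + 1).+1 = 2 * i + 2)%N; last by lia.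
rewrite -(sum_multiplicity_le1 x_nilp); last by lia.
by apply: eq_bigl => j; lia.
Qed.

Lemma gen_fun_four_regular_gt1 N : (n <= 4 * N)%N ->
  gen_fun four_regular_gt1 = \prod_(i < N)
    ((if i == 0%N :> nat then 1 else geom (4 * i + 1)) *
     geom (4 * i + 2) * geom (4 * i + 3)).
Proof.
(* Writing 4N as 2(2N) allows two uses of [prod_ord_double], which group the parts 4i+1, ...,
   4i+4. *)
rewrite -[4%N]/(2 * 2)%N -mulnA => le_n4N.
under eq_bigr => m _.
  have le_m4N : (m <= 2 * (2 * N))%N by apply: leq_trans le_n4N; rewrite -ltnS.
  rewrite (four_regular_gt1_multiplicities le_m4N); over.
rewrite -(prod_multiplicities x_nilp) //.
pose F k := \sum_(j < n.+1 | (j == 0 :> nat) ||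
  (~~ (4 %| k.+1)%N && (1 < k.+1)%N)) x ^+ (k.+1 * j).
rewrite (@prod_ord_double _ _ F).
rewrite (@prod_ord_double _ _ (fun i => F (2 * i)%N * F (2 * i + 1)%N)).
apply: eq_bigr => i _; rewrite mulrA -[RHS]mulr1.
rewrite /F; congr (_ * _ * _ * _).
- rewrite (_ : (2 * (2 * i)).+1 = 4 * i + 1)%N; last by lia.
  case: eqP => i0; last by apply: eq_bigl => j; lia.
  rewrite -[RHS](sum_multiplicity_eq0 x n (4 * i + 1)).
  by apply: eq_bigl => j; lia.
- rewrite (_ : (2 * (2 * i) + 1).+1 = 4 * i + 2)%N; last by lia.
  by apply: eq_bigl => j; lia.
- rewrite (_ : (2 * (2 * i + 1)).+1 = 4 * i + 3)%N; last by lia.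
  by apply: eq_bigl => j; lia.
rewrite (_ : (2 * (2 * i + 1) + 1).+1 = 4 * i + 4)%N; last by lia.
rewrite -[RHS](sum_multiplicity_eq0 x n (4 * i + 4)).
by apply: eq_bigl => j; lia.
Qed.

Lemma gen_fun_four_regular_ped_gt1 : gen_fun four_regular_gt1 = gen_fun ped_gt1.
Proof.
(* With 2n factors, the product for [ped_gt1] can be paired again to match the residues modulo 4.
   The odd parts then agree, and [prod_geom_distinct] treats the even ones. *)
rewrite (@gen_fun_ped_gt1 (2 * n)%N) ?(@gen_fun_four_regular_gt1 n); try lia.
pose F i := (if i == 0%N then 1 else geom (2 * i + 1)) * (1 + x ^+ (2 * i + 2)).
rewrite (@prod_ord_double _ n F) {}/F.
transitivity (\prod_(i < n)
    ((if i == 0%N :> nat then 1 else geom (4 * i + 1)) * geom (4 * i + 3)) *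
  \prod_(i < n) geom (4 * i + 2)).
  by rewrite -big_split; apply: eq_bigr => i _ /=; rewrite mulrAC.
rewrite prod_geom_distinct //; last by lia.
rewrite -big_split; apply: eq_bigr => i _ /=.
rewrite muln_eq0 addn_eq0 andbF /=.
rewrite (_ : 2 * (2 * i) + 1 = 4 * i + 1)%N; last by lia.
rewrite (_ : 2 * (2 * i) + 2 = 4 * i + 2)%N; last by lia.
rewrite (_ : 2 * (2 * i + 1) + 1 = 4 * i + 3)%N; last by lia.
rewrite (_ : 2 * (2 * i + 1) + 2 = 4 * i + 4)%N; last by lia.
by rewrite mulrACA.
Qed.

Lemma gen_fun_ped_gt1_DE2 : (0 < n)%N ->
  gen_fun ped_gt1 = 1 + (1 + x ^+ 3) * gen_fun DE2.
Proof.
move=> n_gt0; rewrite (@gen_fun_ped_gt1 n) ?(@gen_fun_DE2 n); try lia.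
(* The term x^(2n+1) vanishes, and the remaining 1 - x cancels [geom 1], the factor of the part
   1. *)
rewrite -(ped_prod_telescope x_nilp) (expr_nilp x_nilp); last by lia.
rewrite addr0 /ped_prod [LHS](bigD1 (Ordinal n_gt0)) //= mul1r.
rewrite [X in _ = _ * X](bigD1 (Ordinal n_gt0)) //= muln0 add0n !mulrA.
have /= -> : (1 - x) * geom 1 = 1 by exact: (mul_geom x_nilp (k := 1)).
rewrite mul1r; congr (_ * _).
by apply: eq_bigr => i; rewrite -val_eqE => /negbTE->.
Qed.

Lemma expr3_gen_fun_DE2 :
  x ^+ 3 * gen_fun DE2 = gen_fun (fun m => DE2 (m - 3)).
Proof.
pose G (m : nat) := x ^+ m *+ DE2 (m%:Z - 3).
(* Three terms are added at the top, zero by nilpotency; the three lowest are then dropped, since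
   [DE2] vanishes at -3, -2 and -1. *)
have -> : gen_fun (fun m => DE2 (m - 3)) = \sum_(m < n.+4) G m.
  have G_nilp m : (n < m)%N -> G m = 0.
    by move=> lt_nm; rewrite /G (expr_nilp x_nilp) // mul0rn.
  rewrite !(big_ord_recr n.+3) !(big_ord_recr n.+2) !(big_ord_recr n.+1) /=.
  by rewrite (G_nilp n.+1) ?(G_nilp n.+2) ?(G_nilp n.+3) ?addr0 //; lia.
rewrite (big_ord_recl n.+3) (big_ord_recl n.+2) (big_ord_recl n.+1) /G /=.
rewrite !DE2_le0 // !mulr0n !add0r mulr_sumr.
apply: eq_bigr => m _; rewrite /bump /= mulrnAr -exprD.
by congr (_ ^+ _ *+ DE2 _); lia.
Qed.

End CountingFunctions.

(** * Comparison of coefficients in Z[X]/(X^(n+1)) *)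

Section Coefficients.
Local Open Scope ring_scope.

Lemma qpoly_Xn_nilp (n : nat) :
  ('qX : {poly %/ ('X^(n.+1) : {poly int})}) ^+ n.+1 = 0.
Proof.
rewrite -rmorphXn; apply: val_inj => /=.
by rewrite mk_monic_Xn Pdiv.RingMonic.rmodpp ?monicXn.
Qed.

(** A class modulo X^(n+1) has a unique representative of degree at most n, whose integer
    coefficients are here the given naturals. *)
Lemma gen_fun_inj (n : nat) (a b : nat -> nat)
    (x : {poly %/ ('X^(n.+1) : {poly int})} := 'qX) :
  \sum_(m < n.+1) x ^+ m *+ a m = \sum_(m < n.+1) x ^+ m *+ b m ->
  forall m, (m <= n)%N -> a m = b m.
Proof.
have gfE (c : nat -> nat) : \sum_(m < n.+1) x ^+ m *+ c m =
    \poly_(m < n.+1) (c m)%:R :> {poly int}.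
  have -> : \sum_(m < n.+1) x ^+ m *+ c m =
            in_qpoly 'X^(n.+1) (\poly_(m < n.+1) (c m)%:R).
    rewrite poly_def rmorph_sum; apply: eq_bigr => m _.
    by rewrite scaler_nat rmorphMn rmorphXn.
  by rewrite in_qpoly_small // mk_monic_Xn size_polyXn ltnS size_poly.
move=> /(congr1 (fun p : {poly %/ _} => p : {poly int})).
rewrite !gfE => eq_ab m le_mn.
have := congr1 (fun p : {poly int} => p`_m) eq_ab.
by rewrite !coef_poly ltnS le_mn => /eqP; rewrite eqr_nat => /eqP.
Qed.

End Coefficients.

Theorem lemma2p6 (n : int) (n_gt0 : (0 < n)%R) :
  DE2 n + DE2 (n - 3)%R = ped_gt1 n /\
  DE2 n + DE2 (n - 3)%R = four_regular_gt1 n.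
Proof.
case: n n_gt0 => // n; rewrite ltz_nat => n_gt0.
have x_nilp := qpoly_Xn_nilp n.
have <- : ped_gt1 n = four_regular_gt1 n.
  apply: (gen_fun_inj (a := ped_gt1 \o Posz) (b := four_regular_gt1 \o Posz))
           (leqnn n).
  exact/esym/(gen_fun_four_regular_ped_gt1 x_nilp).
(* The summand [(n == 0)] is the coefficient of the constant 1 in [gen_fun_ped_gt1_DE2]; it is 0 for
   positive n. *)
suff : ped_gt1 n = (n == 0) + (DE2 n + DE2 (n%:Z - 3)%R).
  by rewrite eqn0Ngt n_gt0 => /= ->.
pose c m := (m == 0) + (DE2 m + DE2 (m%:Z - 3)%R).
apply: (gen_fun_inj (a := ped_gt1 \o Posz) (b := c)) (leqnn n).
rewrite [LHS](gen_fun_ped_gt1_DE2 x_nilp n_gt0) mulrDl mul1r.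
rewrite expr3_gen_fun_DE2 //.
under [RHS]eq_bigr => m _ do rewrite /c !mulrnDr.
rewrite !big_split; congr (_ + _)%R.
by rewrite big_ord_recl /= big1 ?addr0 ?expr0 ?mulr1n.
Qed.
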